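(* Let $n_1,n_2,\ldots,n_k\in\mathbb{N}$ (positive integers). Then $$W(H(2n_1,2n_2,\ldots,2n_k))\geq \sum_{i=1}^{k}W(K_{2n_i})+\sum_{i=1}^{k-1}i(2n_i-1).$$
   Context: All graphs are finite, undirected, without loops or multiple edges. An interval $t$-coloring of a graph $G$ ($t$ a positive integer) is a proper edge-coloring of $G$ with colors $1,\ldots,t$ such that all colors are used and, for each vertex $v$, the set of colors of the edges incident to $v$ is an interval of integers. $G$ is interval colorable if it has an interval $t$-coloring for some positive integer $t$; then $W(G)$ denotes the maximum such $t$. $K_m$ is the complete graph on $m$ vertices, and the Hamming graph $H(m_1,\ldots,m_k)$ is the Cartesian product $K_{m_1}\square K_{m_2}\square\cdots\square K_{m_k}$. (It is known that $H(m_1,\ldots,m_k)$ is interval colorable whenever $m_1\cdots m_k$ is even; in particular $K_{2n}$ is interval colorable.) *)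

(* Defs.v *)
From mathcomp Require Import all_boot.
From mathcomp Require Import boolp.

Set Implicit Arguments.
Unset Strict Implicit.
Unset Printing Implicit Defensive.

Record sgraph := SGraph {
  vertex :> finType;
  adj : rel vertex;
  adj_sym : symmetric adj;
  adj_irrefl : irreflexive adj
}.

(* Edges are the two-element sets of adjacent vertices, so that an
   edge-coloring is a function on sets of vertices; its values outside
   [edges G] are irrelevant. *)
Definition edges (G : sgraph) : {set {set G}} :=
  [set e : {set G} | [exists x, exists y, adj x y && (e == [set x; y])]].

Definition incident (G : sgraph) (v : G) : {set {set G}} :=
  [set e in edges G | v \in e].

Definition proper_coloring (G : sgraph) (c : {set G} -> nat) : Prop :=
  forall (v : G) (e f : {set G}),
    e \in incident v -> f \in incident v -> c e = c f -> e = f.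

Definition is_interval (A : nat -> Prop) : Prop :=
  forall i j l, A i -> A l -> i <= j <= l -> A j.

Definition spectrum (G : sgraph) (c : {set G} -> nat) (v : G) : nat -> Prop :=
  fun a => exists2 e, e \in incident v & c e = a.

Definition interval_coloring (G : sgraph) (t : nat) (c : {set G} -> nat) :
    Prop :=
  [/\ proper_coloring c,
      (forall e, e \in edges G -> 1 <= c e <= t),
      (forall a, 1 <= a <= t -> exists2 e, e \in edges G & c e = a)
    & forall v : G, is_interval (spectrum c v)].

Definition interval_t_colorable (G : sgraph) (t : nat) : Prop :=
  0 < t /\ exists c : {set G} -> nat, interval_coloring t c.

Definition interval_colorable (G : sgraph) : Prop :=
  exists t, interval_t_colorable G t.

(* An interval t-coloring uses t colors, hence t <= #|edges G|: the bounded
   maximum is the maximum over all t (see [W_max] and [W_attained]).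
   [W G = 0] when [G] is not interval colorable. *)
Definition W (G : sgraph) : nat :=
  \max_(t < #|edges G|.+1 | `[< interval_t_colorable G t >]) t.

Lemma interval_t_colorable_leq_edges (G : sgraph) (t : nat) :
  interval_t_colorable G t -> t <= #|edges G|.
Proof.
move=> [_ [c [_ _ cst _]]].
have -> : t = size (iota 1 t) by rewrite size_iota.
have -> : #|edges G| = size (map c (enum (edges G))) by rewrite size_map -cardE.
apply: uniq_leq_size; first exact: iota_uniq.
move=> a; rewrite mem_iota add1n ltnS => /cst [e eE <-].
by apply: map_f; rewrite mem_enum.
Qed.

Lemma W_max (G : sgraph) (t : nat) : interval_t_colorable G t -> t <= W G.
Proof.
move=> Gt; have tE := interval_t_colorable_leq_edges Gt.
rewrite -ltnS in tE.
by apply: (@leq_bigmax_cond _ _ (fun i : 'I__ => val i) (Ordinal tE)); apply/asboolP.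
Qed.

Lemma W_attained (G : sgraph) :
  interval_colorable G -> interval_t_colorable G (W G).
Proof.
move=> [t Gt]; have tE := interval_t_colorable_leq_edges Gt.
rewrite -ltnS in tE.
have GO : `[< interval_t_colorable G (Ordinal tE) >] by apply/asboolP.
rewrite /W (bigop.bigmax_eq_arg (Ordinal tE)) //.
by case: arg_maxnP => // i /asboolP.
Qed.

Definition complete_adj (m : nat) : rel 'I_m := fun x y => x != y.

Lemma complete_adj_sym (m : nat) : symmetric (@complete_adj m).
Proof. by move=> x y; rewrite /complete_adj eq_sym. Qed.

Lemma complete_adj_irrefl (m : nat) : irreflexive (@complete_adj m).
Proof. by move=> x; rewrite /complete_adj eqxx. Qed.

Definition complete (m : nat) : sgraph :=
  SGraph (@complete_adj_sym m) (@complete_adj_irrefl m).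

Definition cartesian_adj (I : finType) (G : I -> sgraph) :
    rel {dffun forall i : I, G i} :=
  fun x y => [exists i, adj (x i) (y i) &&
                        [forall j, (j != i) ==> (x j == y j)]].

Lemma cartesian_adj_sym (I : finType) (G : I -> sgraph) :
  symmetric (@cartesian_adj I G).
Proof.
move=> x y; apply: eq_existsb => i; rewrite adj_sym; congr (_ && _).
by apply: eq_forallb => j; congr (_ ==> _); rewrite eq_sym.
Qed.

Lemma cartesian_adj_irrefl (I : finType) (G : I -> sgraph) :
  irreflexive (@cartesian_adj I G).
Proof. by move=> x; apply/negbTE/existsPn => i; rewrite adj_irrefl. Qed.

Definition cartesian (I : finType) (G : I -> sgraph) : sgraph :=
  SGraph (@cartesian_adj_sym I G) (@cartesian_adj_irrefl I G).

Definition hamming (k : nat) (m : 'I_k -> nat) : sgraph :=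
  cartesian (fun i => complete (m i)).

(* Main.v *)
Require Import Defs.
From mathcomp Require Import all_boot.
From mathcomp Require Import zify.
From mathcomp Require Import boolp.

Set Implicit Arguments.
Unset Strict Implicit.
Unset Printing Implicit Defensive.

(** The heart of the matter is an inequality for two factors: if [G] is
    [r]-regular, [H] is regular of positive degree [d], and both are interval
    colorable, then

      [W (G box H) >= W G + W H + r].

    In a regular graph the colors at [x] form a block of fixed length starting
    at some [a x], so an interval coloring amounts to a proper coloring
    together with the starting points of these blocks; this is recorded by
    [band_coloring], with colors counted from 0.  Take such colorings of [G]
    and [H] with [t] and [T] colors and starting points [a] and [b].  At the
    vertex [(u, v)], color the [H]-edges as in [H], shifted by [a u + r]; they
    fill a block of length [d] starting at [a u + b v + r].  The [r] edges of
    the copy of [G] at [v], colored as in [G] and shifted, can fill the [r]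
    places just below this block or just above it, and either choice is made
    for a whole copy of [G] at once.  Put the copy above at a single vertex
    [v1] of [H] that sees the largest color of [H], and below everywhere else,
    in particular at a vertex [v0 <> v1] that sees the smallest color.  Then
    the least color is 0, the largest is [t + T + r - 1], and all colors in
    between occur: the copy at [v0], the [H]-edges over a vertex with
    [a u = 0], and the copy at [v1] cover them.  This is [box_band].

    Adding the factors of a product one after the other in some order, each new
    factor gains the degree of what is already there; so the degree [d i] is
    counted once for every factor added after [i] ([iterbox_band],
    [W_cartesian]).  Writing lists with the most recent factor at the head,
    that count is the position of [i] in the list.  For the Hamming graph the
    list [k-1, 0, 1, ..., k-2] of coordinates, numbered from 0, gives the
    coefficient [i + 1] for each [i < k - 1] and 0 for the last coordinate.

    The factors [K_2n] are regular, and they are interval colorable because a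
    one-factorization is a proper coloring of a [(2n-1)-]regular graph with
    [2n-1] colors, so that every vertex sees all of them. *)

(** * Interval colorings of regular graphs *)

(** Interval colorings of a [d]-regular graph, as functions of the two ends of
    an edge and with colors [0, ..., t - 1]: [a x] is the least color at [x].
    Injectivity, range and surjectivity at each vertex together make the graph
    [d]-regular.  The extreme blocks are described through [a] rather than
    through edges so that the one-vertex graph, with [d = t = 0], can start the
    induction over the factors. *)
Record band_coloring (G : sgraph) (d t : nat) (f : G -> G -> nat)
    (a : G -> nat) : Prop := BandColoring {
  band_sym : forall x y, adj x y -> f x y = f y x;
  band_inj : forall x y z, adj x y -> adj x z -> f x y = f x z -> y = z;
  band_range : forall x y, adj x y -> a x <= f x y < a x + d;
  band_onto : forall x c, a x <= c < a x + d -> exists2 y, adj x y & f x y = c;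
  band_le : forall x, a x + d <= t;
  band_colors : forall c, c < t -> exists x y, adj x y /\ f x y = c;
  band_bot : exists x, a x = 0;
  band_top : exists x, a x + d = t
}.

Definition regular (G : sgraph) (d : nat) : Prop :=
  forall x : G, #|[pred y | adj x y]| = d.

Lemma incidentP (G : sgraph) (x : G) (e : {set G}) :
  reflect (exists2 y, adj x y & e = [set x; y]) (e \in incident x).
Proof.
rewrite !inE; apply: (iffP andP) => [[/existsP [u /existsP [v]]]|[y xy ->]].
  case/andP=> uv /eqP ->; rewrite !inE => /orP [] /eqP ->.
    by exists v.
  by exists u; rewrite 1?adj_sym // setUC.
split; last by rewrite !inE eqxx.
by apply/existsP; exists x; apply/existsP; exists y; rewrite xy eqxx.
Qed.

Lemma edgesP (G : sgraph) (e : {set G}) :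
  reflect (exists x y, adj x y /\ e = [set x; y]) (e \in edges G).
Proof.
rewrite inE; apply: (iffP existsP) => [[x /existsP [y /andP [xy /eqP ->]]]|].
  by exists x, y.
by case=> x [y [xy ->]]; exists x; apply/existsP; exists y; rewrite xy eqxx.
Qed.

Lemma set2_inj (T : finType) (x y z : T) : [set x; y] = [set x; z] -> y = z.
Proof.
move=> E; have := set22 x y; rewrite E => /set2P [yx|//].
by have := set22 x z; rewrite -E yx setUid => /set1P.
Qed.

(** Turns a symmetric function of the two ends into a function on edges; the
    value on other sets is arbitrary. *)
Definition set_coloring (G : sgraph) (f : G -> G -> nat) (e : {set G}) : nat :=
  if [pick p : G * G | adj p.1 p.2 && (e == [set p.1; p.2])] is Some p
  then f p.1 p.2 else 0.

Lemma set_coloringE (G : sgraph) (f : G -> G -> nat) (x y : G) :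
  (forall u v, adj u v -> f u v = f v u) ->
  adj x y -> set_coloring f [set x; y] = f x y.
Proof.
move=> fC xy; rewrite /set_coloring; case: pickP => [[u v] /= /andP [uv /eqP E]|].
  have := set21 u v; rewrite -E !inE => /orP [] /eqP ux; subst u.
    by rewrite (set2_inj E).
  by rewrite (fC _ _ xy) (@set2_inj _ y x v) // setUC.
by move=> /(_ (x, y)) /=; rewrite xy eqxx.
Qed.

Lemma band_interval (G : sgraph) (d t : nat) (f : G -> G -> nat) (a : G -> nat) :
  band_coloring d t f a ->
  interval_coloring t (fun e => (set_coloring f e).+1).
Proof.
move=> B; have fE x y := set_coloringE (x := x) (y := y) (band_sym B).
split.
- move=> x e e' /incidentP [y xy ->] /incidentP [z xz ->] [].
  by rewrite !fE // => /(band_inj B xy xz) ->.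
- move=> e /edgesP [x [y [xy ->]]]; rewrite fE //=.
  by have := band_range B xy; have := band_le B x; lia.
- move=> [|c] //= ct; have [x [y [xy fc]]] := band_colors B ct.
  by exists [set x; y]; [apply/edgesP; exists x, y | rewrite fE ?fc].
- move=> x i j l [e /incidentP [y xy ->] <-] [e' /incidentP [z xz ->] <-].
  rewrite !fE // => ij.
  have [w xw fw] : exists2 w, adj x w & f x w = j.-1.
    by apply: (band_onto B); have := band_range B xy; have := band_range B xz; lia.
  exists [set x; w]; first by apply/incidentP; exists w.
  by rewrite fE // fw; lia.
Qed.

(** Pigeonhole: [d] edges with distinct colors from a block of [d] colors use
    the whole block. *)
Lemma inj_onto_iota (G : sgraph) (d : nat) (f : G -> G -> nat) (x : G) (a : nat) :
  regular G d ->
  (forall y z, adj x y -> adj x z -> f x y = f x z -> y = z) ->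
  (forall y, adj x y -> a <= f x y < a + d) ->
  forall c, a <= c < a + d -> exists2 y, adj x y & f x y = c.
Proof.
move=> reg finj fr c cr.
set s := map (f x) (enum [pred y | adj x y]).
have us : uniq s.
  rewrite map_inj_in_uniq ?enum_uniq // => y z; rewrite !mem_enum !inE.
  exact: finj.
have sub : {subset s <= iota a d}.
  move=> i /mapP [y]; rewrite mem_enum inE mem_iota => xy ->; exact: fr.
have [|_ E] := uniq_min_size us sub.
  by rewrite size_iota size_map -cardE reg.
have : c \in s by rewrite E mem_iota.
by case/mapP=> y; rewrite mem_enum inE => xy ->; exists y.
Qed.

(** The spectrum of a vertex is an interval, and by properness it has [d]
    elements, so it is the block of length [d] above its least element. *)
Lemma interval_band (G : sgraph) (d t : nat) (c : {set G} -> nat) :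
  regular G d -> 0 < d -> 0 < t -> interval_coloring t c ->
  exists f a, @band_coloring G d t f a.
Proof.
move=> reg d0 t0 [cprop cr cst cint].
pose f (x y : G) := (c [set x; y]).-1.
have cpos (x y : G) : adj x y -> 1 <= c [set x; y] <= t.
  by move=> xy; apply: cr; apply/edgesP; exists x, y.
have finj x y z : adj x y -> adj x z -> f x y = f x z -> y = z.
  move=> xy xz; rewrite /f => E; apply: (@set2_inj _ x).
  apply: (cprop x).
  - by apply/incidentP; exists y.
  - by apply/incidentP; exists z.
  by have := cpos _ _ xy; have := cpos _ _ xz; lia.
have low x : exists y, adj x y /\ forall z, adj x z -> f x y <= f x z.
  have [|y0 xy0] := @card_gt0P _ [pred y | adj x y] _; first by rewrite reg.
  case: (@arg_minnP _ y0 [pred y | adj x y] (f x) xy0) => y xy ym.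
  by exists y.
have [m mP] := choice low.
pose a x := f x (m x).
have fbetween x y i : adj x y -> a x <= i <= f x y ->
    exists2 z, adj x z & f x z = i.
  move=> xy ir; have [xm _] := mP x.
  have [|||e /incidentP [z xz ->] E] := cint x (c [set x; m x]) i.+1 (c [set x; y]).
  - by exists [set x; m x] => //; apply/incidentP; exists (m x).
  - exists [set x; y] => //; first by apply/incidentP; exists y.
  - by have := cpos _ _ xy; have := cpos _ _ xm; move: ir; rewrite /a /f; lia.
  - by exists z => //; rewrite /f E.
have fr x y : adj x y -> a x <= f x y < a x + d.
  move=> xy; have [_ xmin] := mP x; rewrite xmin //=.
  (* all colors from [a x] to [f x y] occur at [x], hence there are at most
     [d] of them *)
  set N := [pred z | adj x z].
  suff: size (iota (a x) ((f x y).+1 - a x)) <= size (map (f x) (enum N)).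
    by rewrite size_iota size_map -cardE reg; lia.
  apply: uniq_leq_size; first exact: iota_uniq.
  move=> i; rewrite mem_iota => ir.
  have [|z xz <-] := fbetween x y i xy.
    by have := xmin y xy; move: ir; rewrite /a; lia.
  by apply: map_f; rewrite mem_enum.
have fonto x := inj_onto_iota reg (finj x) (fr x).
have fcol i : i < t -> exists x y, adj x y /\ f x y = i.
  move=> it; have [|e /edgesP [x [y [xy ->]]] E] := cst i.+1; first by [].
  by exists x, y; rewrite /f E.
have ft x y : adj x y -> f x y < t.
  by move=> xy; have := cpos _ _ xy; rewrite /f; lia.
have ale x : a x + d <= t.
  have [|y xy fy] := fonto x (a x + d.-1); first by lia.
  by have := ft _ _ xy; lia.
exists f, a; split => //.
- by move=> x y _; rewrite /f setUC.
- have [x [y [xy fy]]] := fcol 0 t0; exists x; have := fr _ _ xy; lia.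
- have [|x [y [xy fy]]] := fcol t.-1; first lia.
  by exists x; have := fr _ _ xy; have := ale x; lia.
Qed.

(** With only [d] colors on a [d]-regular graph, every vertex sees all of
    them, so any proper coloring is an interval coloring. *)
Lemma class1_band (G : sgraph) (d : nat) (f : G -> G -> nat) (x0 : G) :
  regular G d ->
  (forall x y, adj x y -> f x y = f y x) ->
  (forall x y z, adj x y -> adj x z -> f x y = f x z -> y = z) ->
  (forall x y, adj x y -> f x y < d) ->
  @band_coloring G d d f (fun=> 0).
Proof.
move=> reg fC finj fd.
have fonto x := @inj_onto_iota G d f x 0 reg (finj x) (fd x).
split => //; try by exists x0.
by move=> c cd; have [y] := fonto x0 c cd; exists x0, y.
Qed.

(** * Complete graphs of even order *)

Lemma complete_regular (m : nat) : regular (complete m) (m - 1).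
Proof.
move=> x; have := cardC1 x; rewrite [in X in _ = X -> _]card_ord -subn1 => <-.
by apply: eq_card => y; rewrite !inE /= /complete_adj eq_sym.
Qed.

(** The round-robin tournament: with [N = 2n - 1], the vertices other than [N]
    are the residues modulo [N], the edge [xy] gets the color [x + y], and the
    edge from [x] to the extra vertex [N] gets the color [2x], which is the one
    that no other edge at [x] uses.  At the vertex [N] the colors differ because
    [N] is odd. *)
Lemma complete_even_colorable (n : nat) :
  0 < n -> interval_colorable (complete (2 * n)).
Proof.
move=> n0; pose N := 2 * n - 1.
(* an end equal to [N] is replaced by the other end, which gives [2x] *)
pose f (x y : complete (2 * n)) : nat :=
  ((if x == N :> nat then y else x) + (if y == N :> nat then x else y)) %% N.
have lt2n : 0 < 2 * n by lia.
have finj (x y z : complete (2 * n)) : adj x y -> adj x z -> f x y = f x z -> y = z.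
  rewrite /= /complete_adj -!val_eqE /= => xy xz; rewrite /f => E; apply: val_inj => /=.
  have modE (i j : nat) : i < N -> j < N -> i = j %[mod N] -> i = j.
    by move=> iN jN; rewrite !modn_small.
  have xN := ltn_ord x; have yN := ltn_ord y; have zN := ltn_ord z.
  move: E; case: eqP => [xE|/eqP xE].
    rewrite !ifF; [|lia|lia].
    (* [n] is an inverse of 2 modulo [N] *)
    have halve (i : nat) : i = n * (i + i) %[mod N].
      suff -> : n * (i + i) = i * N + i by rewrite modnMDl.
      rewrite /N mulnBr muln1 subnK ?leq_pmulr //.
      by rewrite addnn -mul2n mulnCA [RHS]mulnCA (mulnC n).
    move=> E; apply: modE; [lia | lia |].
    by rewrite (halve y) -modnMmr E modnMmr -halve.
  case: eqP => [yE|/eqP yE]; case: eqP => [zE|/eqP zE] E.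
  - lia.
  - by move: E => /eqP; rewrite eqn_modDl => /eqP /modE; lia.
  - by move: E => /eqP; rewrite eqn_modDl => /eqP /modE; lia.
  - by move: E => /eqP; rewrite eqn_modDl => /eqP /modE; lia.
exists N; split; first by rewrite /N; lia.
eexists; apply: band_interval.
apply: (@class1_band _ N f (Ordinal lt2n)) => //.
- exact: complete_regular.
- by move=> x y _; rewrite /f addnC.
- by move=> x y _; rewrite /f ltn_mod /N; lia.
Qed.

(** * The product of two regular graphs *)

Definition box_adj (G H : sgraph) : rel (G * H)%type := fun p q =>
  (adj p.1 q.1 && (p.2 == q.2)) || ((p.1 == q.1) && adj p.2 q.2).

Lemma box_adj_sym (G H : sgraph) : symmetric (@box_adj G H).
Proof.
by move=> p q; rewrite /box_adj adj_sym (eq_sym p.2) (eq_sym p.1) (adj_sym p.2).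
Qed.

Lemma box_adj_irrefl (G H : sgraph) : irreflexive (@box_adj G H).
Proof. by move=> p; rewrite /box_adj !adj_irrefl andbF. Qed.

Definition box (G H : sgraph) : sgraph :=
  SGraph (@box_adj_sym G H) (@box_adj_irrefl G H).

Lemma box_adjP (G H : sgraph) (u u' : G) (v v' : H) :
  reflect ((adj u u' /\ v = v') \/ (u = u' /\ adj v v'))
    (@adj (box G H) (u, v) (u', v')).
Proof.
rewrite /= /box_adj /=; apply: (iffP orP) => -[].
- by case/andP=> ? /eqP; left.
- by case/andP=> /eqP; right.
- by case=> -> ->; rewrite eqxx; left.
- by case=> -> ->; rewrite eqxx; right.
Qed.

(** If the only vertex seeing color 0 were also the only one seeing the top
    color, then [t = d], and every vertex sees all colors; as [0 < d], there is
    another vertex. *)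
Lemma band_ends (G : sgraph) (d t : nat) (f : G -> G -> nat) (a : G -> nat) :
  0 < d -> band_coloring d t f a ->
  exists x y, [/\ a x = 0, a y + d = t & x != y].
Proof.
move=> d0 B; have [x x0] := band_bot B; have [y yt] := band_top B.
case: (eqVneq x y) => [E|]; last by exists x, y.
have [|z yz _] := band_onto B (x := y) (c := a y); first lia.
exists z, y; split => //.
  by have := band_le B z; subst y; lia.
by apply/eqP => zy; move: yz; rewrite zy adj_irrefl.
Qed.

(** The combination of the two colorings, in which the copy of [G] at [v1] is
    placed above the [H]-edges and all other copies below. *)
Lemma box_band (G H : sgraph) (r t d T : nat) f a g b :
  0 < d -> @band_coloring G r t f a -> @band_coloring H d T g b ->
  exists F A, @band_coloring (box G H) (r + d) (t + T + r) F A.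
Proof.
move=> d0 BG BH.
have [v0 [v1 [v0P v1P v01]]] := band_ends d0 BH.
have [u0 u0P] := band_bot BG; have [u1 u1P] := band_top BG.
pose F (p q : box G H) := if p.2 == q.2
  then f p.1 q.1 + b p.2 + (if p.2 == v1 then r + d else 0)
  else g p.2 q.2 + a p.1 + r.
(* At [v1] the [H]-edges come first, so the block starts [r] later than at
   the other vertices, and the copy of [G] moves up by [r + d]. *)
pose A (p : box G H) := a p.1 + b p.2 + (if p.2 == v1 then r else 0).
have neq v v' : @adj H v v' -> (v == v') = false.
  by apply: contraTF => /eqP ->; rewrite adj_irrefl.
have FG u u' v : F (u, v) (u', v) = f u u' + b v + (if v == v1 then r + d else 0).
  by rewrite /F /= eqxx.
have FH u u' v v' : adj v v' -> F (u, v) (u', v') = g v v' + a u + r.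
  by move=> vv; rewrite /F /= neq.
exists F, A; split.
- move=> [u v] [u' v'] /box_adjP [[uu <-]|[<- vv]].
    by rewrite !FG (band_sym BG uu).
  by rewrite !FH // 1?adj_sym // (band_sym BH vv).
- move=> [u v] [u1' v1'] [u2 v2] /box_adjP [[uu <-]|[<- vv]]
    /box_adjP [[uu' <-]|[<- vv']].
  + by rewrite !FG => E; rewrite (band_inj BG uu uu') //; lia.
  + rewrite FG FH //; have := band_range BG uu; have := band_range BH vv'.
    by case: eqP; lia.
  + rewrite FG FH //; have := band_range BG uu'; have := band_range BH vv.
    by case: eqP; lia.
  + by rewrite !FH // => E; rewrite (band_inj BH vv vv') //; lia.
- move=> [u v] [u' v'] /box_adjP [[uu <-]|[<- vv]]; rewrite /A /=.
    by rewrite FG; have := band_range BG uu; case: eqP; lia.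
  by rewrite FH //; have := band_range BH vv; case: eqP; lia.
- move=> [u v] c; rewrite /A /= => cr.
  have [cH|cH] := boolP (b v + a u + r <= c < b v + a u + r + d).
    have [|v' vv E] := band_onto BH (x := v) (c := c - a u - r); first lia.
    by exists (u, v'); [apply/box_adjP; right | rewrite FH // E; lia].
  have [|u' uu E] :=
    band_onto BG (x := u) (c := c - b v - (if v == v1 then r + d else 0)).
    by move: cr cH; case: eqP; lia.
  exists (u', v); first by apply/box_adjP; left.
  by rewrite FG E; move: cr cH; case: eqP; lia.
- move=> [u v]; rewrite /A /=; have := band_le BG u; have := band_le BH v.
  by case: eqP; lia.
- move=> c ct.
  (* the three ranges [0, t), [r, r + T) and [r + T, r + T + t) cover
     everything because [r <= t] *)
  have rt : r <= t by rewrite -u1P leq_addl.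
  have [clo|clo] := ltnP c t.
    have [u [u' [uu E]]] := band_colors BG clo.
    exists (u, v0), (u', v0); split; first by apply/box_adjP; left.
    by rewrite FG (negbTE v01) E; lia.
  have [cmid|chi] := ltnP c (r + T).
    have [|v [v' [vv E]]] := band_colors BH (c := c - r); first lia.
    exists (u0, v), (u0, v'); split; first by apply/box_adjP; right.
    by rewrite FH // E; lia.
  have [|u [u' [uu E]]] := band_colors BG (c := c - T - r); first lia.
  exists (u, v1), (u', v1); split; first by apply/box_adjP; left.
  by rewrite FG eqxx E; lia.
- by exists (u0, v0); rewrite /A /= (negbTE v01); lia.
- by exists (u1, v1); rewrite /A /= eqxx; lia.
Qed.

(** * Products of several graphs *)

(** Transport along a graph isomorphism [h]. *)
Lemma band_iso (G H : sgraph) (d t : nat) f a (h : G -> H) :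
  (forall x y, adj (h x) (h y) = adj x y) -> injective h ->
  (forall y, exists x, h x = y) ->
  @band_coloring H d t f a ->
  @band_coloring G d t (fun x y => f (h x) (h y)) (a \o h).
Proof.
move=> hadj hinj hsurj B; split=> /=.
- by move=> x y; rewrite -hadj; apply: band_sym B _ _.
- by move=> x y z; rewrite -!hadj => xy xz /(band_inj B xy xz) /hinj.
- by move=> x y; rewrite -hadj; apply: band_range B _ _.
- move=> x c /(band_onto B) [y]; have [z <-] := hsurj y.
  by rewrite hadj; exists z.
- by move=> x; apply: band_le B _.
- move=> c /(band_colors B) [x [y []]]; have [u <-] := hsurj x.
  by have [v <-] := hsurj y; rewrite hadj; exists u, v.
- by have [x] := band_bot B; have [u <-] := hsurj x; exists u.
- by have [x] := band_top B; have [u <-] := hsurj x; exists u.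
Qed.

Fixpoint iterbox (I : finType) (G : I -> sgraph) (s : seq I) : sgraph :=
  if s is i :: s' then box (iterbox G s') (G i) else complete 1.

(** The isomorphism from the cartesian product onto the iterated one when [s]
    lists every index exactly once.  For the induction over [s] it is
    described below for all duplicate-free [s]. *)
Fixpoint coords (I : finType) (G : I -> sgraph) (s : seq I)
    (x : {dffun forall i, G i}) : iterbox G s :=
  if s is i :: s' then (coords s' x, x i) else ord0.

Lemma coords_eq (I : finType) (G : I -> sgraph) (s : seq I)
    (x y : {dffun forall i, G i}) :
  reflect {in s, forall i, x i = y i} (coords s x == coords s y).
Proof.
elim: s => [|i s IH] /=; first by rewrite eqxx; left.
rewrite xpair_eqE; apply: (iffP andP) => [[/IH xy /eqP xyi] j|xy].
  by rewrite inE => /orP [/eqP ->|/xy].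
split; last by rewrite xy // inE eqxx.
by apply/IH => j js; rewrite xy // inE js orbT.
Qed.

Lemma coords_adj (I : finType) (G : I -> sgraph) (s : seq I)
    (x y : {dffun forall i, G i}) :
  uniq s ->
  reflect (exists i, [/\ i \in s, adj (x i) (y i) &
                      {in s, forall j, j != i -> x j = y j}])
    (adj (coords s x) (coords s y)).
Proof.
elim: s => [_|i s IH /= /andP [iNs us]]; first by right=> -[i []].
apply: (iffP (box_adjP _ _ _ _)) => [[[/(IH us) [j [js xyj xy]] xyi]|]|].
- exists j; split=> //; first by rewrite inE js orbT.
  by move=> l; rewrite inE => /orP [/eqP -> //|ls]; apply: xy.
- case=> /eqP/coords_eq xy xyi; exists i; split; rewrite ?inE ?eqxx //.
  by move=> l; rewrite inE => /orP [/eqP ->|/xy //]; rewrite eqxx.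
- case=> j [+ xyj xy]; rewrite inE => /orP [/eqP ji|js]; [right|left].
    subst j; split=> //; apply/eqP/coords_eq => l ls.
    apply: xy; first by rewrite inE ls orbT.
    by apply: contraNneq iNs => <-.
  split; last first.
    by apply: xy; rewrite ?inE ?eqxx //; apply: contraNneq iNs => ->.
  apply/(IH us); exists j; split=> // l ls; apply: xy.
  by rewrite inE ls orbT.
Qed.

(** The vertex [x0] supplies the coordinates outside [s]. *)
Lemma coords_surj (I : finType) (G : I -> sgraph) (s : seq I)
    (x0 : {dffun forall i, G i}) (y : iterbox G s) :
  uniq s -> exists x, coords s x = y.
Proof.
elim: s y => [y _|i s IH [y yi] /= /andP [iNs us]].
  by exists x0; rewrite [y]ord1.
have [x xy] := IH y us.
pose x' : {dffun forall i, G i} := [ffun j => dfwith x yi j].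
exists x'; congr (_, _); last by rewrite ffunE dfwith_in.
rewrite -xy; apply/eqP/coords_eq => j js; rewrite ffunE dfwith_out //.
by apply: contraNneq iNs => ->.
Qed.

(** Putting [i] at the head of [s] adds the degree [\sum_(j <- s) d j] of the
    product so far, which is the effect on the sum of every index in [s] moving
    one place to the right. *)
Lemma iterbox_band (I : finType) (G : I -> sgraph) (d : I -> nat) (s : seq I) :
  uniq s -> (forall i, 0 < d i) -> (forall i, regular (G i) (d i)) ->
  (forall i, interval_colorable (G i)) ->
  exists f a, @band_coloring (iterbox G s) (\sum_(i <- s) d i)
    (\sum_(i <- s) (W (G i) + index i s * d i)) f a.
Proof.
move=> us d0 reg col; elim: s us => [_|i s IH /= /andP [iNs us]].
  rewrite !big_nil; exists (fun _ _ => 0), (fun=> 0).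
  split=> //; try by exists ord0.
  by move=> x y z; rewrite /= /complete_adj [x]ord1 [y]ord1.
  by move=> x y; rewrite /= /complete_adj [x]ord1 [y]ord1.
have [f [a B]] := IH us.
have [t0 [c cP]] := W_attained (col i).
have [g [b C]] := interval_band (reg i) (d0 i) t0 cP.
have [F [A D]] := box_band (d0 i) B C.
exists F, A; rewrite !big_cons eqxx mul0n addn0 addnC.
suff -> : \sum_(j <- s) (W (G j) + (if i == j then 0 else (index j s).+1) * d j)
   = \sum_(j <- s) (W (G j) + index j s * d j) + \sum_(j <- s) d j.
  by rewrite addnA (addnC (W _)).
rewrite -big_split /= big_seq [RHS]big_seq; apply: eq_bigr => j js.
rewrite ifF; last by apply: contraNF iNs => /eqP ->.
by rewrite mulSn; lia.
Qed.

(** The bound depends on the order [s] in which the factors are added, the head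
    of [s] being the last one. *)
Theorem W_cartesian (I : finType) (G : I -> sgraph) (d : I -> nat) (s : seq I) :
  uniq s -> s =i I -> (forall i, 0 < d i) -> (forall i, regular (G i) (d i)) ->
  (forall i, interval_colorable (G i)) ->
  \sum_(i <- s) (W (G i) + index i s * d i) <= W (cartesian G).
Proof.
move=> us sI d0 reg col.
have [f [a B]] := iterbox_band us d0 reg col.
case: (posnP (\sum_(i <- s) (W (G i) + index i s * d i))) => [-> //|t0].
apply: W_max; split=> //; eexists; apply: band_interval.
have x0 : cartesian G.
  have ne i : exists x : G i, true.
    have [t [tpos [c [_ _ cst _]]]] := col i.
    by have [|e /edgesP [x _] _] := cst t; [lia | exists x].
  exact: [ffun i => xchoose (ne i)].
apply: (band_iso (G := cartesian G) (h := @coords I G s)) B.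
- move=> x y; apply/(coords_adj _ _ us)/existsP => [] [i].
    case=> _ xyi xy; exists i; rewrite xyi /=.
    by apply/forallP => j; apply/implyP => /xy -> //; rewrite sI.
  case/andP=> xyi /forallP xy; exists i; split; rewrite ?sI // => j _ ji.
  by apply/eqP; have := xy j; rewrite ji.
- by move=> x y /eqP/coords_eq xy; apply/ffunP => i; apply: xy; rewrite sI.
- by move=> y; apply: coords_surj.
Qed.

(** * Hamming graphs *)

Theorem theorem6p3 (k : nat) (n : 'I_k -> nat) (hk : 0 < k)
    (hn : forall i, 0 < n i) :
  \sum_(i < k) W (complete (2 * n i))
    + \sum_(i < k | i.+1 < k) i.+1 * (2 * n i - 1)
  <= W (hamming (fun i => 2 * n i)).
Proof.
case: k n hk hn => [//|k] n _ hn.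
set w := widen_ord (leqnSn k).
have winj : injective w by move=> i j /(congr1 val) /= /val_inj.
have maxNw : ord_max \notin map w (enum 'I_k).
  by apply/mapP => -[i _ /(congr1 val) /= E]; have := ltn_ord i; lia.
(* [ord_max] is added last and so has coefficient 0; then the index of each
   other [i] in [s] is [i.+1] *)
pose s := ord_max :: map w (enum 'I_k).
have us : uniq s by rewrite /= maxNw map_inj_uniq ?enum_uniq.
have sI : s =i 'I_k.+1.
  move=> i; rewrite !inE; case: (unliftP ord_max i) => [j ->|->]; last by rewrite eqxx.
  have -> : lift ord_max j = w j by apply: val_inj; apply: lift_max.
  by rewrite map_f ?orbT // mem_enum.
apply: leq_trans (W_cartesian us sI (d := fun i => 2 * n i - 1) _ _ _); first last.
- by move=> i; apply: complete_even_colorable.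
- by move=> i; apply: complete_regular.
- by move=> i; have := hn i; lia.
rewrite [leqRHS]big_split.
apply: eq_leq; congr addn.
  by rewrite (perm_big s) //; apply: uniq_perm; rewrite ?index_enum_uniq // => i;
    rewrite sI mem_index_enum.
rewrite big_cons /= eqxx mul0n add0n big_map big_enum /=.
rewrite big_mkcond big_ord_recr /= ltnn addn0; apply: eq_bigr => i _.
rewrite ltnS ltn_ord ifF; last first.
  by apply: contraNF maxNw => /eqP ->; rewrite map_f ?mem_enum.
by rewrite index_map // index_enum_ord.
Qed.
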